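(* Let $B:\mathbb Z\to\mathrm M(2,\mathbb C)$ be a bounded sequence that admits dominated splitting. Then there exists $\varepsilon>0$ such that every $\widetilde B:\mathbb Z\to\mathrm M(2,\mathbb C)$ with $\|\widetilde B-B\|_\infty<\varepsilon$ admits dominated splitting.
   Context: $\mathrm M(2,\mathbb C)$ is the set of complex $2\times2$ matrices, $\mathbb Z_+$ the positive integers, and $\|B\|_\infty=\sup_{j\in\mathbb Z}\|B(j)\|$. For $B:\mathbb Z\to \mathrm M(2,\mathbb C)$ and $n\ge1$ put $B_n(j)=B(j+n-1)\cdots B(j)$. For one-dimensional subspaces $V,W$ of $\mathbb C^2$ put $d(V,W)=\frac{2|\det(\vec v,\vec w)|}{\|\vec v\|\,\|\vec w\|}$ for any nonzero $\vec v\in V$, $\vec w\in W$. Definition. A sequence $B\in\ell^\infty(\mathbb Z,\mathrm M(2,\mathbb C))$ admits dominated splitting if for each $j\in\mathbb Z$ there are one-dimensional subspaces $E^u(j),E^s(j)$ of $\mathbb C^2$ such that: (1) $B(j)[E^u(j)]\subseteq E^u(j+1)$ and $B(j)[E^s(j)]\subseteq E^s(j+1)$ for all $j\in\mathbb Z$; (2) there exist $N\in\mathbb Z_+$ and $\lambda>1$ such that $\|B_N(j)\vec u\|>\lambda\|B_N(j)\vec s\|$ for all $j\in\mathbb Z$ and all unit vectors $\vec u\in E^u(j)$, $\vec s\in E^s(j)$; (3) there exists $\delta>0$ such that $d(E^u(j),E^s(j))>\delta$ for all $j\in\mathbb Z$; (4) for the $N$ of condition (2), $\inf_{j\in\mathbb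 Z}\|B_N(j)\|>0$. *)

(* Defs.v *)
From HB Require Import structures.
From mathcomp Require Import all_boot all_order all_algebra.
From mathcomp Require Import complex.
From mathcomp Require Import boolp classical_sets reals constructive_ereal ereal.

Set Implicit Arguments.
Unset Strict Implicit.
Unset Printing Implicit Defensive.

Import Order.TTheory GRing.Theory Num.Theory.

Local Open Scope classical_set_scope.
Local Open Scope ring_scope.
Local Open Scope complex_scope.

Definition cmod (R : realType) (z : R[i]) : R := ComplexField.Normc.normc z.

(* Euclidean norm; the library norm on matrices is the sup norm. *)
Definition vnorm (R : realType) (v : 'cV[R[i]]_2) : R :=
  Num.sqrt (\sum_(i < 2) cmod (v i ord0) ^+ 2).

Definition opnorm (R : realType) (A : 'M[R[i]]_2) : R :=
  sup [set vnorm (A *m v) | v in [set v : 'cV[R[i]]_2 | vnorm v = 1]].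

Lemma opnorm_has_sup (R : realType) (A : 'M[R[i]]_2) :
  has_sup [set vnorm (A *m v) | v in [set v : 'cV[R[i]]_2 | vnorm v = 1]].
Proof.
have cmod_ge0 (z : R[i]) : 0 <= cmod z by case: z => a b; exact: sqrtr_ge0.
split.
  exists (vnorm (A *m delta_mx ord0 ord0)), (delta_mx ord0 ord0) => //=.
  rewrite /vnorm big_ord_recl big_ord1 !mxE !eqxx /=.
  by rewrite !expr1n expr0n /= !addr0 sqrtr0 sqrtr1 expr1n expr0n addr0 sqrtr1.
exists (Num.sqrt (\sum_(i < 2) (\sum_(j < 2) cmod (A i j)) ^+ 2)).
move=> _ [v /= v1 <-]; apply: ler_wsqrtr; apply: ler_sum => i _.
rewrite ler_sqr ?nnegrE ?sumr_ge0 // mxE.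
have v_le1 j : cmod (v j ord0) <= 1.
  rewrite -(ler_pXn2r (ltn0Sn 1)) ?nnegrE // expr1n.
  have -> : 1 = vnorm v ^+ 2 :> R by rewrite v1 expr1n.
  rewrite sqr_sqrtr ?sumr_ge0 // => [|k _]; last exact: sqr_ge0.
  by rewrite (bigD1 j) //= lerDl sumr_ge0 // => k _; exact: sqr_ge0.
apply: (@le_trans _ _ (\sum_(j < 2) cmod (A i j * v j ord0))).
  elim/big_ind2: _ => [|x1 y1 x2 y2 h1 h2|//].
    by rewrite /cmod ComplexField.Normc.normc0.
  exact: le_trans (le_normcD _ _) (lerD h1 h2).
apply: ler_sum => j _; rewrite /cmod ComplexField.Normc.normcM.
by rewrite -[leRHS]mulr1 ler_wpM2l ?cmod_ge0 ?v_le1.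
Qed.

(* Taken in \bar R, so that it is +oo on unbounded sequences. *)
Definition seqnorm (R : realType) (B : int -> 'M[R[i]]_2) : \bar R :=
  ereal_sup [set (opnorm (B j))%:E | j in [set: int]].

Definition bounded_seq (R : realType) (B : int -> 'M[R[i]]_2) : Prop :=
  (seqnorm B < +oo)%E.

(* B (j + n - 1) *m ... *m B j, and the identity for n = 0. *)
Fixpoint cocycle (R : realType) (B : int -> 'M[R[i]]_2) (n : nat) (j : int) :
    'M[R[i]]_2 :=
  if n is m.+1 then B (j + m%:Z) *m cocycle B m j else 1%:M.

Definition vdist (R : realType) (v w : 'cV[R[i]]_2) : R :=
  2 * cmod (\det (row_mx v w : 'M[R[i]]_2)) / (vnorm v * vnorm w).

(* The choice of the nonzero representatives does not matter: line_distE. *)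
Definition line_dist (R : realType) (V W : {vspace 'cV[R[i]]_2}) : R :=
  vdist (vpick V) (vpick W).

Lemma vnormZ (R : realType) (c : R[i]) (v : 'cV[R[i]]_2) :
  vnorm (c *: v) = cmod c * vnorm v.
Proof.
have c0 : 0 <= cmod c by case: c => a b; exact: sqrtr_ge0.
rewrite /vnorm -(ger0_norm c0) -sqrtr_sqr -sqrtrM ?sqr_ge0 // mulr_sumr.
congr Num.sqrt; apply: eq_bigr => i _.
by rewrite mxE /cmod ComplexField.Normc.normcM exprMn.
Qed.

Lemma vdistZ (R : realType) (a b : R[i]) (v w : 'cV[R[i]]_2) :
  a != 0 -> b != 0 -> vdist (a *: v) (b *: w) = vdist v w.
Proof.
move=> a0 b0.
have nz (c : R[i]) : c != 0 -> cmod c != 0.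
  by apply: contra => /eqP/ComplexField.Normc.eq0_normc ->.
have -> : vdist (a *: v) (b *: w) =
    2 * (cmod a * cmod b * cmod (\det (row_mx v w : 'M[R[i]]_2))) /
    ((cmod a * cmod b) * (vnorm v * vnorm w)).
  rewrite /vdist !vnormZ mulrACA; congr (2 * _ / _).
  rewrite /cmod -!ComplexField.Normc.normcM; congr ComplexField.Normc.normc.
  have -> : row_mx (a *: v) (b *: w) = (row_mx v w : 'M[R[i]]_2) *m
      diag_mx (\row_(j < 2) if (j < 1)%N then a else b).
    apply/matrixP => i j; rewrite mul_mx_diag !mxE mulrC.
    by case: (@splitP 1 1 j) => k _; rewrite !mxE.
  by rewrite (@det_mulmx _ 2) det_diag mulrC big_ord_recl big_ord1 !mxE.
by rewrite /vdist [2 * _]mulrCA invfM mulrACA divff ?mul1r // mulf_neq0 ?nz.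
Qed.

Lemma line_distE (R : realType) (V W : {vspace 'cV[R[i]]_2})
    (v w : 'cV[R[i]]_2) :
  \dim V = 1%N -> \dim W = 1%N -> v \in V -> w \in W -> v != 0 -> w != 0 ->
  line_dist V W = vdist v w.
Proof.
have pickP (U : {vspace 'cV[R[i]]_2}) u : \dim U = 1%N -> u \in U -> u != 0 ->
    exists2 c, c != 0 & vpick U = c *: u.
  move=> dU uU u0.
  have /eqP defU : (<[u]> == U)%VS.
    by rewrite eqEdim -memvE uU dU dim_vline u0.
  have /vlineP[c pE] : vpick U \in <[u]>%VS by rewrite defU memv_pick.
  exists c => //; apply: contra_eq_neq pE => ->.
  by rewrite scale0r vpick0 -dimv_eq0 dU.
move=> dV dW vV wW v0 w0.
have [a a0 aE] := pickP _ _ dV vV v0.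
have [b b0 bE] := pickP _ _ dW wW w0.
by rewrite /line_dist aE bE vdistZ.
Qed.

(* Part of the definition that B is bounded. *)
Definition dominated_splitting (R : realType) (B : int -> 'M[R[i]]_2) : Prop :=
  bounded_seq B /\
  exists Eu Es : int -> {vspace 'cV[R[i]]_2},
    (forall j, \dim (Eu j) = 1%N /\ \dim (Es j) = 1%N) /\
    (forall j,
       (forall v, v \in Eu j -> B j *m v \in Eu (j + 1)) /\
       (forall v, v \in Es j -> B j *m v \in Es (j + 1))) /\
    (exists (N : nat) (lambda : R), (0 < N)%N /\ 1 < lambda /\
       (forall j u s, u \in Eu j -> s \in Es j -> vnorm u = 1 -> vnorm s = 1 ->
          vnorm (cocycle B N j *m u) > lambda * vnorm (cocycle B N j *m s)) /\
       0 < inf [set opnorm (cocycle B N j) | j in [set: int]]) /\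
    (exists delta : R, 0 < delta /\
       forall j, line_dist (Eu j) (Es j) > delta).

(* Main.v *)
(** Dominated splitting is equivalent to the existence of a bounded, uniformly
    transversal moving frame (u, s) in which B is diagonal, B u_j = a_j u_(j+1)
    and B s_j = d_j s_(j+1), with |a_j| bounded below and |d_j| <= rho |a_j| for
    some rho < 1: domination in N steps becomes domination in one step after
    rescaling the s_j.  In this frame a perturbation of B acts on lines
    near u by a forward Moebius recursion and on lines near s by a backward one.
    Both are uniform contractions of the unit disc (B itself need not be
    invertible, since for s the recursion uses only the pull-back of lines), so
    each has a bounded orbit indexed by Z; these orbits are the slopes of the
    perturbed frame. *)
Require Import Defs.
From mathcomp Require Import all_boot all_order all_algebra.
From mathcomp Require Import complex ring lra.
From mathcomp Require Import boolp classical_sets reals constructive_ereal ereal.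

Set Implicit Arguments.
Unset Strict Implicit.
Unset Printing Implicit Defensive.

Import Order.TTheory GRing.Theory Num.Theory.

Local Open Scope classical_set_scope.
Local Open Scope ring_scope.
Local Open Scope complex_scope.

(** * Elementary properties of the complex modulus *)

Section Modulus.
Variable R : realType.
Implicit Types x y z : R[i].

Lemma cmod_ge0 z : 0 <= cmod z.
Proof. by case: z => a b; exact: sqrtr_ge0. Qed.

Lemma cmod0 : cmod (0 : R[i]) = 0.
Proof. exact: ComplexField.Normc.normc0. Qed.

Lemma cmod1 : cmod (1 : R[i]) = 1.
Proof. exact: ComplexField.Normc.normc1. Qed.

Lemma cmodM x y : cmod (x * y) = cmod x * cmod y.
Proof. exact: ComplexField.Normc.normcM. Qed.

Lemma cmodV x : cmod x^-1 = (cmod x)^-1.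
Proof. exact: ComplexField.Normc.normcV. Qed.

Lemma cmodN x : cmod (- x) = cmod x.
Proof. exact: normcN. Qed.

Lemma cmodD x y : cmod (x + y) <= cmod x + cmod y.
Proof. exact: le_normcD. Qed.

Lemma cmodB x y : cmod (x - y) <= cmod x + cmod y.
Proof. by rewrite -(cmodN y); exact: cmodD. Qed.

Lemma cmod_lowerD x y : cmod x - cmod y <= cmod (x + y).
Proof. by have := cmodB (x + y) y; rewrite addrK; lra. Qed.

Lemma cmod_eq0 z : (cmod z == 0) = (z == 0).
Proof.
apply/eqP/eqP => [/ComplexField.Normc.eq0_normc //|->]; exact: cmod0.
Qed.

Lemma cmod_gt0 z : (0 < cmod z) = (z != 0).
Proof. by rewrite lt_def cmod_ge0 andbT cmod_eq0. Qed.

Lemma cmod_prod n (f : nat -> R[i]) :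
  cmod (\prod_(k < n) f k) = \prod_(k < n) cmod (f k).
Proof.
by elim: n => [|n ih]; rewrite ?big_ord0 ?cmod1 // !big_ord_recr /= cmodM ih.
Qed.

Lemma cmod_real (r : R) : cmod r%:C = `|r|.
Proof. by rewrite /cmod /= expr0n /= addr0 sqrtr_sqr. Qed.

Lemma abs_Re_le z : `|complex.Re z| <= cmod z.
Proof.
case: z => a b /=; rewrite -sqrtr_sqr; apply: ler_wsqrtr.
by rewrite lerDl sqr_ge0.
Qed.

Lemma abs_Im_le z : `|complex.Im z| <= cmod z.
Proof.
case: z => a b /=; rewrite -sqrtr_sqr; apply: ler_wsqrtr.
by rewrite lerDr sqr_ge0.
Qed.

Lemma cmod_le_ReIm z : cmod z <= `|complex.Re z| + `|complex.Im z|.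
Proof.
have hi (r : R) : cmod (0 +i* r) = `|r|.
  by rewrite /cmod /= expr0n /= add0r sqrtr_sqr.
have -> : cmod z = cmod ((complex.Re z)%:C + (0 +i* complex.Im z)).
  by case: z => a b; rewrite /= add0r addr0.
by apply: le_trans (cmodD _ _) _; rewrite cmod_real hi.
Qed.

End Modulus.

(** * The Euclidean norm and the determinant of two vectors in the plane *)

Section Norm.
Variable R : realType.
Implicit Types (v w : 'cV[R[i]]_2) (A : 'M[R[i]]_2).

Local Notation i0 := (ord0 : 'I_2).
Local Notation i1 := (lift ord0 ord0 : 'I_2).

(** Seen as the modulus of a single complex number, the Euclidean norm inherits its triangle
    inequality from [cmod]. *)
Lemma vnormE v : vnorm v = cmod ((cmod (v i0 ord0)) +i* (cmod (v i1 ord0))).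
Proof. by rewrite /vnorm big_ord_recl big_ord1. Qed.

Lemma vnorm_ge0 v : 0 <= vnorm v.
Proof. exact: sqrtr_ge0. Qed.

Lemma vnorm0 : vnorm (0 : 'cV[R[i]]_2) = 0.
Proof. by rewrite -(scale0r 0) vnormZ cmod0 mul0r. Qed.

Lemma vnormD v w : vnorm (v + w) <= vnorm v + vnorm w.
Proof.
rewrite !vnormE; apply: le_trans (cmodD _ _).
rewrite !mxE /cmod; apply: ler_wsqrtr.
by apply: lerD; rewrite ler_sqr ?nnegrE ?cmodD ?addr_ge0 ?cmod_ge0.
Qed.

Lemma coord_le v i : cmod (v i ord0) <= vnorm v.
Proof.
rewrite -[leLHS]ger0_norm ?cmod_ge0 // -sqrtr_sqr; apply: ler_wsqrtr.
by rewrite (bigD1 i) //= lerDl sumr_ge0 // => k _; exact: sqr_ge0.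
Qed.

Lemma vnorm_gt0 v : (0 < vnorm v) = (v != 0).
Proof.
rewrite lt_def vnorm_ge0 andbT; congr negb.
apply/eqP/eqP => [v0|->]; last exact: vnorm0.
apply/colP => i; rewrite !mxE; apply/eqP; rewrite -cmod_eq0 eq_le cmod_ge0 andbT.
by rewrite -v0 coord_le.
Qed.

Definition det2 v w : R[i] :=
  v i0 ord0 * w i1 ord0 - v i1 ord0 * w i0 ord0.

Lemma det_row_mx v w : \det (row_mx v w : 'M[R[i]]_2) = det2 v w.
Proof.
rewrite (expand_det_row _ (ord0 : 'I_2)) big_ord_recl big_ord1.
rewrite /cofactor !det_mx11 !mxE.
have e0 : split (ord0 : 'I_(1 + 1)) = inl ord0.
  by case: splitP => // j _; rewrite ord1.
have e1 (k : 'I_2) : k = 1%N :> nat -> split (k : 'I_(1 + 1)) = inr ord0.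
  by move=> k1; case: splitP => // j; rewrite ?(ord1 j) k1.
have -> : lift (lift ord0 ord0) 0 = ord0 :> 'I_2 by exact/val_inj.
have -> : lift ord0 0 = i1 by exact/val_inj.
rewrite e0 e1 //= addn0 expr0 expr1 /det2; ring.
Qed.

(** Hadamard's inequality. After the triangle inequality it is Lagrange's identity: the two squared
    sides differ by the square of [a * c - b * d]. *)
Lemma det2_le v w : cmod (det2 v w) <= vnorm v * vnorm w.
Proof.
apply: le_trans (cmodB _ _) _; rewrite !cmodM /vnorm -sqrtrM; last first.
  by apply: sumr_ge0 => k _; exact: sqr_ge0.
rewrite !big_ord_recl !big_ord0 !addr0.
set a := cmod (v i0 _); set b := cmod (v i1 _).
set c := cmod (w i0 _); set d := cmod (w i1 _).
have [a0 b0 c0 d0] : [/\ 0 <= a, 0 <= b, 0 <= c & 0 <= d].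
  by split; exact: cmod_ge0.
rewrite -[leLHS]ger0_norm ?addr_ge0 ?mulr_ge0 // -sqrtr_sqr; apply: ler_wsqrtr.
rewrite -subr_ge0; have -> : (a ^+ 2 + b ^+ 2) * (c ^+ 2 + d ^+ 2) -
  (a * d + b * c) ^+ 2 = (a * c - b * d) ^+ 2 by ring.
exact: sqr_ge0.
Qed.

Lemma det2Z (a b : R[i]) v w : det2 (a *: v) (b *: w) = a * b * det2 v w.
Proof. by rewrite /det2 !mxE; ring. Qed.

Lemma det2_shear (x y : R[i]) v w :
  det2 (v + x *: w) (w + y *: v) = (1 - x * y) * det2 v w.
Proof. by rewrite /det2 !mxE; ring. Qed.

(** Cramer's rule; Hadamard's inequality bounds the numerators. *)
Lemma det2_decomp u w v : det2 u w != 0 ->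
  exists a b, [/\ v = a *: u + b *: w,
    cmod a <= vnorm v * vnorm w / cmod (det2 u w) &
    cmod b <= vnorm v * vnorm u / cmod (det2 u w)].
Proof.
move=> d0; exists (det2 v w / det2 u w), (- det2 v u / det2 u w).
have dgt0 : 0 < (cmod (det2 u w))^-1 by rewrite invr_gt0 cmod_gt0.
split; last 2 first.
- by rewrite cmodM cmodV ler_pM2r // det2_le.
- by rewrite cmodM cmodV cmodN ler_pM2r // det2_le.
apply/colP => i; rewrite !mxE.
have [->|->] : i = i0 \/ i = i1.
- by case: i => [[|[|//]] ?]; [left|right]; exact/val_inj.
- by move: d0; rewrite /det2 => d0; field.
- by move: d0; rewrite /det2 => d0; field.
Qed.

End Norm.

(** * Operator norms, bounded sequences, and cocycles along invariant vectors *)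

Section OperatorNorm.
Variable R : realType.
Implicit Types (v : 'cV[R[i]]_2) (A : 'M[R[i]]_2) (B : int -> 'M[R[i]]_2).

Lemma vnorm_normalize v : v != 0 -> vnorm ((vnorm v)^-1%:C *: v) = 1.
Proof.
rewrite -vnorm_gt0 => v0.
by rewrite vnormZ cmod_real ger0_norm ?invr_ge0 ?vnorm_ge0 // mulVf ?gt_eqF.
Qed.

Lemma vnorm_mulmx_le A v : vnorm (A *m v) <= opnorm A * vnorm v.
Proof.
have [->|v0] := eqVneq v 0; first by rewrite mulmx0 vnorm0 mulr0.
have vgt0 : 0 < vnorm v by rewrite vnorm_gt0.
rewrite -ler_pdivrMr // mulrC -[X in X * _]ger0_norm ?invr_ge0 ?vnorm_ge0 //.
rewrite -cmod_real -vnormZ scalemxAr.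
apply: (sup_ubound (opnorm_has_sup A).2).
by exists ((vnorm v)^-1%:C *: v) => //=; exact: vnorm_normalize.
Qed.

Lemma opnorm_le A (c : R) :
  (forall v, vnorm v = 1 -> vnorm (A *m v) <= c) -> opnorm A <= c.
Proof.
move=> h; apply: ge_sup; first exact: (opnorm_has_sup A).1.
by move=> _ [v /= v1 <-]; exact: h.
Qed.

Lemma opnorm_ge A v (c : R) :
  v != 0 -> c * vnorm v <= vnorm (A *m v) -> c <= opnorm A.
Proof.
rewrite -vnorm_gt0 => v0 h; rewrite -(ler_pM2r v0).
exact: le_trans h (vnorm_mulmx_le A v).
Qed.

(** Replaces the suprema by a homogeneous bound on vectors, the form in which both boundedness and
    closeness of sequences are used below. *)
Lemma seqnorm_leP B (c : R) :
  (seqnorm B <= c%:E)%E <->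
  forall j v, vnorm (B j *m v) <= c * vnorm v.
Proof.
split=> [h j v|h].
  apply: le_trans (vnorm_mulmx_le _ _) _; apply: ler_wpM2r; first exact: vnorm_ge0.
  by rewrite -lee_fin; apply: le_trans h; apply: ereal_sup_ubound; exists j.
apply: ge_ereal_sup => _ [j _ <-]; rewrite lee_fin; apply: opnorm_le => v v1.
by rewrite -[c]mulr1 -v1.
Qed.

Lemma bounded_seqP B :
  bounded_seq B <->
  exists2 M : R, 1 <= M & forall j v, vnorm (B j *m v) <= M * vnorm v.
Proof.
split=> [h|[M _ /seqnorm_leP h]]; last exact: le_lt_trans h (ltry M).
have [M h'] : exists M : R, (seqnorm B <= M%:E)%E.
  move: h; rewrite /bounded_seq; case: (seqnorm B) => [r _|//|_].
    by exists r.
  by exists 0; rewrite leNye.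
exists (Num.max 1 M); first by rewrite le_max lexx.
by apply/seqnorm_leP; apply: le_trans h' _; rewrite lee_fin le_max lexx orbT.
Qed.

Lemma cocycle_eigen B (u : int -> 'cV[R[i]]_2) (a : int -> R[i]) n j :
  (forall j, B j *m u j = a j *: u (j + 1)) ->
  cocycle B n j *m u j =
    (\prod_(k < n) a (j + k%:Z)) *: u (j + n%:Z).
Proof.
move=> Bu; elim: n => [|n ih] /=; first by rewrite mul1mx big_ord0 scale1r addr0.
rewrite -mulmxA ih -scalemxAr Bu scalerA big_ord_recr /=; congr (_ *: u _).
by rewrite -addrA -PoszD addn1.
Qed.

End OperatorNorm.

(** * Geometric convergence and bounded orbits of contractions *)

Section Contraction.
Variable R : realType.

Lemma bernoulli_ineq (x : R) n : -1 <= x -> 1 + n%:R * x <= (1 + x) ^+ n.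
Proof.
move=> x1; elim: n => [|n ih]; first by rewrite mul0r addr0 expr0.
have h : (1 + x) * (1 + n%:R * x) <= (1 + x) * (1 + x) ^+ n.
  by apply: ler_wpM2l => //; lra.
rewrite exprS; apply: le_trans h.
rewrite -natr1; have : 0 <= n%:R * (x * x) :> R by rewrite mulr_ge0 // -expr2 sqr_ge0.
lra.
Qed.

(** For [r] nonzero, Bernoulli's inequality makes the powers of [r^-1] grow at least linearly. *)
Lemma expr_small (r e : R) : 0 <= r -> r < 1 -> 0 < e ->
  exists n, r ^+ n < e.
Proof.
move=> r0 r1 e0; have [->|rn0] := eqVneq r 0.
  by exists 1%N; rewrite expr1.
have {rn0} rgt0 : 0 < r by rewrite lt_def rn0.
have h0 : 0 < r^-1 - 1 by rewrite subr_gt0 invf_gt1.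
set N := Num.bound (e^-1 / (r^-1 - 1)); exists N.
have hN : e^-1 / (r^-1 - 1) < N%:R.
  by apply: archi_boundP; rewrite divr_ge0 ?invr_ge0 // ltW.
rewrite -[ltLHS]invrK -exprVn invf_plt ?posrE ?exprn_gt0 ?invr_gt0 //.
have : 1 + N%:R * (r^-1 - 1) <= r^-1 ^+ N.
  have := @bernoulli_ineq (r^-1 - 1) N.
  have -> : 1 + (r^-1 - 1) = r^-1 by ring.
  by apply; lra.
by move: hN; rewrite ltr_pdivrMr //; lra.
Qed.

(** With [C = c / (1 - r)], which solves [c + C * r = C], the intervals of radius [C * r ^+ n]
    around [s n] are nested. The supremum of their left endpoints lies in all of them. *)
Lemma geometric_cauchy_limit (s : nat -> R) (c r : R) :
  0 <= c -> 0 <= r -> r < 1 ->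
  (forall n, `|s n.+1 - s n| <= c * r ^+ n) ->
  exists l, forall n, `|l - s n| <= c / (1 - r) * r ^+ n.
Proof.
move=> c0 r0 r1 hs; set C := c / (1 - r).
have C0 : 0 <= C by rewrite divr_ge0 // subr_ge0 ltW.
have Cstep n : c * r ^+ n + C * r ^+ n.+1 = C * r ^+ n.
  by rewrite exprS /C; field; rewrite lt0r_neq0 ?subr_gt0.
have mono_up n k : s (n + k)%N + C * r ^+ (n + k) <= s n + C * r ^+ n.
  elim: k => [|k ih]; first by rewrite addn0.
  rewrite addnS; apply: le_trans ih.
  by have := hs (n + k)%N; have := Cstep (n + k)%N; rewrite ler_norml; lra.
have mono_lo n k : s n - C * r ^+ n <= s (n + k)%N - C * r ^+ (n + k).
  elim: k => [|k ih]; first by rewrite addn0.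
  rewrite addnS; apply: le_trans ih _.
  by have := hs (n + k)%N; have := Cstep (n + k)%N; rewrite ler_norml; lra.
have ub n m : s n - C * r ^+ n <= s m + C * r ^+ m.
  have := mono_lo n m; have := mono_up m n; rewrite (addnC m n).
  have : 0 <= C * r ^+ (n + m) by rewrite mulr_ge0 ?exprn_ge0.
  lra.
pose S := [set s n - C * r ^+ n | n in [set: nat]].
have S0 : S !=set0 by exists (s 0%N - C * r ^+ 0), 0%N.
exists (sup S) => m; rewrite ler_norml; apply/andP; split.
  suff : s m - C * r ^+ m <= sup S by lra.
  apply: sup_ubound; last by exists m.
  by exists (s 0%N + C * r ^+ 0) => _ [n _ <-].
suff : sup S <= s m + C * r ^+ m by lra.
by apply: ge_sup => // _ [n _ <-].
Qed.

(** Real and imaginary parts converge separately; adding their errors doubles the constant. *)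
Lemma geometric_cauchy_limitC (s : nat -> R[i]) (c r : R) :
  0 <= c -> 0 <= r -> r < 1 ->
  (forall n, cmod (s n.+1 - s n) <= c * r ^+ n) ->
  exists l, forall n, cmod (l - s n) <= (c / (1 - r) *+ 2) * r ^+ n.
Proof.
move=> c0 r0 r1 hs.
have [x hx] : exists x, forall n,
    `|x - complex.Re (s n)| <= c / (1 - r) * r ^+ n.
  apply: geometric_cauchy_limit => // n; apply: le_trans (hs n).
  by apply: le_trans (abs_Re_le _); case: (s n) (s n.+1) => ? ? [? ?].
have [y hy] : exists y, forall n,
    `|y - complex.Im (s n)| <= c / (1 - r) * r ^+ n.
  apply: geometric_cauchy_limit => // n; apply: le_trans (hs n).
  by apply: le_trans (abs_Im_le _); case: (s n) (s n.+1) => ? ? [? ?].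
exists (x +i* y) => n; apply: le_trans (cmod_le_ReIm _) _.
rewrite mulr2n mulrDl; apply: lerD.
  by move: (hx n); case: (s n).
by move: (hy n); case: (s n).
Qed.

(* The solution is the limit of f_(j-1) o ... o f_(j-n) applied to 0. *)
Lemma contraction_orbit (f : int -> R[i] -> R[i]) (r : R) :
  0 <= r -> r < 1 ->
  (forall j z, cmod z <= 1 -> cmod (f j z) <= r) ->
  (forall j z w, cmod z <= 1 -> cmod w <= 1 ->
     cmod (f j z - f j w) <= r * cmod (z - w)) ->
  exists z : int -> R[i], forall j, cmod (z j) <= r /\ z (j + 1) = f j (z j).
Proof.
move=> r0 r1 fr flip.
pose s := fix s n (j : int) : R[i] :=
  if n is m.+1 then f (j - 1) (s m (j - 1)) else 0.
have s1 n j : cmod (s n j) <= 1.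
  elim: n j => [|n ih] j.
    by have -> : s 0%N j = 0 by []; rewrite cmod0.
  exact: le_trans (fr _ _ (ih _)) (ltW r1).
have sstep n j : cmod (s n.+1 j - s n j) <= 1 * r ^+ n.
  elim: n j => [|n ih] j.
    by rewrite [s 0%N j]/= subr0 mulr1; exact: s1.
  rewrite [s n.+2 j]/= -/(s n.+1 (j - 1)) [s n.+1 j in X in _ - X]/= -/(s n (j - 1)).
  apply: le_trans (flip _ _ _ (s1 _ _) (s1 _ _)) _.
  by rewrite exprS mulrCA ler_wpM2l.
have [z hz] := choice (fun j => geometric_cauchy_limitC ler01 r0 r1 (sstep^~ j)).
set C := 1 / (1 - r) *+ 2 in hz.
have C0 : 0 <= C by rewrite mulrn_wge0 // divr_ge0 // subr_ge0 ltW.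
have small (x K : R) : 0 <= K -> (forall n, x <= K * r ^+ n) -> x <= 0.
  move=> K0 h; rewrite leNgt; apply/negP => x0.
  (* The power is made smaller than [x / (K + 1)]; the added 1 keeps the denominator positive when
     [K] is 0. *)
  have [n hn] := expr_small r0 r1 (divr_gt0 x0 (ltr_wpDl K0 ltr01)).
  have := h n; apply/negP; rewrite -ltNge.
  move: hn; rewrite ltr_pdivlMr ?ltr_wpDl // mulrDr mulr1.
  by have := exprn_ge0 n r0; rewrite mulrC; lra.
have zr j : cmod (z j) <= r.
  rewrite -subr_le0; apply: (small _ C) => // n.
  have := hz j n.+1; have := fr (j - 1) _ (s1 n (j - 1)).
  have := cmodD (z j - s n.+1 j) (s n.+1 j); rewrite subrK /= exprS.
  have : C * (r * r ^+ n) <= C * r ^+ n.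
    by rewrite ler_wpM2l // ler_piMl ?exprn_ge0 // ltW.
  lra.
(* Both sides of the orbit equation lie within [C * r ^+ n] of [f j (s n j)], for every [n]. *)
exists z => j; split=> //; apply/eqP; rewrite -subr_eq0 -cmod_eq0 eq_le cmod_ge0 andbT.
apply: (small _ (C *+ 2)) => [|n]; first exact: mulrn_wge0.
have := hz (j + 1) n.+1; rewrite /= addrK -/(s n j) => h1.
have h2 := flip j _ _ (s1 n j) (le_trans (zr j) (ltW r1)).
have h3 : cmod (s n j - z j) <= C * r ^+ n by rewrite -cmodN opprB.
have h4 : r * cmod (s n j - z j) <= C * r ^+ n.
  by apply: le_trans h3; rewrite ler_piMl ?cmod_ge0 // ltW.
have h5 : C * r ^+ n.+1 <= C * r ^+ n.
  by rewrite exprS ler_wpM2l // ler_piMl ?exprn_ge0 // ltW.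
have := cmodD (z (j + 1) - f j (s n j)) (f j (s n j) - f j (z j)).
rewrite addrA subrK mulr2n mulrDl; lra.
Qed.

End Contraction.

(** * Moebius maps that contract the closed unit disc *)

Section Moebius.
(** The map [x |-> (c + b * x) / (a + d * x)] is the action on slopes of a nearly diagonal matrix:
    [a] and [b] are its diagonal entries, [c] and [d] its off-diagonal ones. [A] stands for the
    modulus of the unperturbed dominant entry, [t] for the relative size of the perturbation. *)
Variables (R : realType) (t A : R) (a b c d : R[i]).
Hypotheses (t_gt0 : 0 < t) (t_le : 10 * t <= 1) (A_gt0 : 0 < A).
Hypotheses (a_ge : (1 - t) * A <= cmod a) (a_le : cmod a <= (1 + t) * A).
Hypotheses (b_le : cmod b <= (1 - 9 * t) * A).
Hypotheses (c_le : cmod c <= t * A) (d_le : cmod d <= t * A).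

Lemma moebius_den_ge x : cmod x <= 1 -> (1 - 2 * t) * A <= cmod (a + d * x).
Proof.
move=> x1; apply: le_trans (cmod_lowerD _ _); rewrite cmodM.
have : cmod d * cmod x <= cmod d by rewrite ler_piMr ?cmod_ge0.
move: a_ge d_le; lra.
Qed.

Lemma moebius_num_le x :
  cmod x <= 1 -> cmod (c + b * x) <= (1 - t) * cmod (a + d * x).
Proof.
move=> x1; apply: (@le_trans _ _ ((1 - t) * ((1 - 2 * t) * A))); last first.
  by rewrite ler_wpM2l ?moebius_den_ge //; move: t_gt0 t_le; lra.
apply: le_trans (cmodD _ _) _; rewrite cmodM.
have : cmod b * cmod x <= cmod b by rewrite ler_piMr ?cmod_ge0.
have : 0 < t * A by rewrite mulr_gt0.
have : 0 < t * t * A by rewrite !mulr_gt0.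
move: b_le c_le; lra.
Qed.

Lemma moebius_den_gt0 x : cmod x <= 1 -> 0 < cmod (a + d * x).
Proof.
move=> x1; apply: lt_le_trans (moebius_den_ge x1).
by rewrite mulr_gt0 //; move: t_le; lra.
Qed.

Lemma moebius_le x : cmod x <= 1 -> cmod ((c + b * x) / (a + d * x)) <= 1 - t.
Proof.
move=> x1; rewrite cmodM cmodV ler_pdivrMr ?moebius_den_gt0 //.
exact: moebius_num_le.
Qed.

Lemma moebius_contracts x y : cmod x <= 1 -> cmod y <= 1 ->
  cmod ((c + b * x) / (a + d * x) - (c + b * y) / (a + d * y)) <=
    (1 - t) * cmod (x - y).
Proof.
move=> x1 y1; have dx := moebius_den_gt0 x1; have dy := moebius_den_gt0 y1.
(* The numerator of the difference is the determinant times [x - y], so it remains to compare the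
   determinant with the product of the denominators. *)
have -> : (c + b * x) / (a + d * x) - (c + b * y) / (a + d * y) =
    (a * b - c * d) * (x - y) / ((a + d * x) * (a + d * y)).
  by field; rewrite -!cmod_gt0 dx dy.
rewrite !cmodM cmodV cmodM ler_pdivrMr ?mulr_gt0 // mulrAC ler_wpM2r ?cmod_ge0 //.
have den : ((1 - 2 * t) * A) ^+ 2 <= cmod (a + d * x) * cmod (a + d * y).
  by rewrite expr2 ler_pM ?moebius_den_ge // mulr_ge0 ?(ltW A_gt0) //; move: t_le; lra.
apply: (@le_trans _ _ ((1 - t) * ((1 - 2 * t) * A) ^+ 2)); last first.
  by rewrite ler_wpM2l //; move: t_le; lra.
apply: le_trans (cmodB _ _) _; rewrite !cmodM.
have ab : cmod a * cmod b <= (1 + t) * A * ((1 - 9 * t) * A).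
  by rewrite ler_pM ?cmod_ge0.
have cd : cmod c * cmod d <= t * A * (t * A) by rewrite ler_pM ?cmod_ge0.
apply: le_trans (lerD ab cd) _; rewrite -subr_ge0.
have -> : (1 - t) * ((1 - 2 * t) * A) ^+ 2 -
    ((1 + t) * A * ((1 - 9 * t) * A) + t * A * (t * A)) =
  (t * (3 + 16 * t - 4 * t ^+ 2)) * A ^+ 2 by ring.
rewrite mulr_ge0 ?sqr_ge0 // mulr_ge0 ?ltW //.
have : t ^+ 2 <= t by rewrite expr2 ler_piMr ?ltW //; move: t_le; lra.
move: t_gt0 t_le; lra.
Qed.

End Moebius.

(** * Dominated frames and their persistence under small perturbations *)

Section DominatedFrame.
Variable R : realType.
Implicit Types B : int -> 'M[R[i]]_2.

(** The frame is not normalised, so that slopes and rescalings can be absorbed in it; [K] and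
    [delta] together bound the lengths below, by Hadamard's inequality. *)
Definition dominated_frame B : Prop :=
  exists (u s : int -> 'cV[R[i]]_2) (a d : int -> R[i]) (K delta m rho : R),
  [/\ [/\ 0 < K, 0 < delta, 0 < m, 0 <= rho & rho < 1],
      forall j, [/\ vnorm (u j) <= K, vnorm (s j) <= K &
                    delta <= cmod (det2 (u j) (s j))],
      forall j, B j *m u j = a j *: u (j + 1) /\
                B j *m s j = d j *: s (j + 1) &
      forall j, m <= cmod (a j) /\ cmod (d j) <= rho * cmod (a j)].

Lemma dominated_frame_open B : dominated_frame B ->
  exists2 eps : R, 0 < eps & forall B',
    (forall j v, vnorm ((B' j - B j) *m v) <= eps * vnorm v) ->
    dominated_frame B'.
Proof.
move=> [u [s [a [d [K [delta [m [rho [[K0 delta0 m0 rho0 rho1] us Bus ad]]]]]]]]].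
(* A tenth of the spectral gap is the unit of loss: all errors cost a few multiples of [t], and a
   rate [1 - t] survives. *)
have [t [t0 t1 rhoE]] : exists t : R, [/\ 0 < t, 10 * t <= 1 & rho = 1 - 10 * t].
  exists ((1 - rho) / 10); split; last by field.
    by rewrite divr_gt0 ?subr_gt0.
  lra.
(* Chosen so that, by Cramer's rule, the coordinates of the perturbation in the frame are at most
   [t * m], hence at most [t * cmod (a j)]. *)
exists (t * m * delta / (K * K)) => [|B' hB'].
  by rewrite divr_gt0 // !mulr_gt0.
have det_neq0 j : det2 (u j) (s j) != 0.
  by rewrite -cmod_gt0; case: (us j) => _ _; exact: lt_le_trans.
have small j w v : vnorm w <= K -> vnorm v <= K ->
    vnorm ((B' j - B j) *m w) * vnorm v / cmod (det2 (u (j + 1)) (s (j + 1))) <=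
    t * cmod (a j).
  move=> wK vK; have [_ _ dj] := us (j + 1).
  rewrite ler_pdivrMr; last exact: lt_le_trans dj.
  apply: (@le_trans _ _ (t * m * delta)); last first.
    apply: ler_pM => //; rewrite ?mulr_ge0 ?(ltW t0) ?(ltW m0) ?(ltW delta0) //.
    by rewrite ler_pM2l //; case: (ad j).
  apply: (@le_trans _ _ (t * m * delta / (K * K) * K * K)); last first.
    by rewrite le_eqVlt; apply/orP; left; apply/eqP; field; rewrite gt_eqF.
  apply: ler_pM; rewrite ?vnorm_ge0 //; apply: le_trans (hB' _ _) _.
  by rewrite ler_wpM2l // divr_ge0 ?mulr_ge0 // ltW.
(* The matrix of [B' j] in the old frame, with the bounds assumed for the Moebius maps, where [A] is
   [cmod (a j)]. *)
have coefs j : exists c : (R[i] * R[i]) * (R[i] * R[i]),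
    [/\ B' j *m u j = c.1.1 *: u (j + 1) + c.1.2 *: s (j + 1),
        B' j *m s j = c.2.1 *: u (j + 1) + c.2.2 *: s (j + 1),
        [/\ (1 - t) * cmod (a j) <= cmod c.1.1 &
            cmod c.1.1 <= (1 + t) * cmod (a j)],
        cmod c.2.2 <= (1 - 9 * t) * cmod (a j) &
        cmod c.1.2 <= t * cmod (a j) /\ cmod c.2.1 <= t * cmod (a j)].
  have [uK sK _] := us j; have [uK' sK' _] := us (j + 1).
  have [p [r [pr hp hr]]] :=
    det2_decomp ((B' j - B j) *m u j) (det_neq0 (j + 1)).
  have [q [w [qw hq hw]]] :=
    det2_decomp ((B' j - B j) *m s j) (det_neq0 (j + 1)).
  have {}hp := le_trans hp (small _ _ _ uK sK').
  have {}hr := le_trans hr (small _ _ _ uK uK').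
  have {}hq := le_trans hq (small _ _ _ sK sK').
  have {}hw := le_trans hw (small _ _ _ sK uK').
  have [Bu Bs] := Bus j; have [_ hd] := ad j.
  exists ((a j + p, r), (q, d j + w)) => /=; split.
  - by rewrite -(subrK (B j) (B' j)) mulmxDl pr Bu scalerDl addrC addrA.
  - by rewrite -(subrK (B j) (B' j)) mulmxDl qw Bs scalerDl -addrA (addrC (d j *: _)).
  - by have := cmod_lowerD (a j) p; have := cmodD (a j) p; split; lra.
  - by have := cmodD (d j) w; move: hd; rewrite rhoE; lra.
  - by [].
have {coefs} [c hc] := choice coefs.
pose al j := (c j).1.1; pose r j := (c j).1.2.
pose q j := (c j).2.1; pose be j := (c j).2.2.
have a0 j : 0 < cmod (a j) by case: (ad j) => ma _; exact: lt_le_trans ma.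
have r0 : 0 <= 1 - t by lra.
have r1 : 1 - t < 1 by lra.
(* The recursion says that [B' j] sends the line of [u j + x j *: s j] into the next such line. *)
have [x hx] : exists x : int -> R[i], forall j, cmod (x j) <= 1 - t /\
    x (j + 1) = (r j + be j * x j) / (al j + q j * x j).
  apply: (@contraction_orbit _ (fun j x => (r j + be j * x) / (al j + q j * x))) => //.
    move=> j z z1; have [_ _ [h1 h2] h3 [h4 h5]] := hc j.
    exact: (moebius_le t0 t1 (a0 j)).
  move=> j z w z1 w1; have [_ _ [h1 h2] h3 [h4 h5]] := hc j.
  exact: (moebius_contracts t0 t1 (a0 j)).
(* The stable directions solve a contracting recursion that runs backwards. *)
have [y hy] : exists y : int -> R[i], forall j, cmod (y j) <= 1 - t /\
    y j = (- q j + be j * y (j + 1)) / (al j + - r j * y (j + 1)).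
  (* Solving [q j + al j * y j = y (j + 1) * (be j + r j * y j)] for [y j] gives a map of the same
     Moebius form. It takes the slope at [j + 1] to that at [j], so time is reversed by [j |-> - j],
     which turns its index into [- j - 1]. *)
  pose g j z := (- q j + be j * z) / (al j + - r j * z).
  have [z hz] : exists z : int -> R[i], forall j,
      cmod (z j) <= 1 - t /\ z (j + 1) = g (- j - 1) (z j).
    apply: (@contraction_orbit _ (fun j => g (- j - 1))) => //.
      move=> j z z1; have [_ _ [h1 h2] h3 [h4 h5]] := hc (- j - 1).
      by apply: (moebius_le t0 t1 (a0 (- j - 1))); rewrite ?cmodN.
    move=> j z w z1 w1; have [_ _ [h1 h2] h3 [h4 h5]] := hc (- j - 1).
    by apply: (moebius_contracts t0 t1 (a0 (- j - 1))); rewrite ?cmodN.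
  exists (fun j => z (- j)) => j; split; first by case: (hz (- j)).
  have [_] := hz (- j - 1); rewrite subrK => ->.
  by rewrite opprB opprK addrAC subrr add0r opprD.
have x1 j : cmod (x j) <= 1 by case: (hx j); lra.
have y1 j : cmod (y j) <= 1 by case: (hy j); lra.
exists (fun j => u j + x j *: s j), (fun j => s j + y j *: u j).
exists (fun j => al j + q j * x j), (fun j => be j + r j * y j).
(* Slopes of modulus at most 1 at most double the lengths. The determinant is multiplied by
   [1 - x j * y j], of modulus at least [t]. *)
exists (2 * K), (t * delta), ((1 - 2 * t) * m), (1 - t); split.
- by split=> //; rewrite mulr_gt0 //; lra.
- move=> j; have [uK sK dj] := us j; split.
  + apply: le_trans (vnormD _ _) _; rewrite vnormZ.
    have := ler_piMl (vnorm_ge0 (s j)) (x1 j); lra.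
  + apply: le_trans (vnormD _ _) _; rewrite vnormZ.
    have := ler_piMl (vnorm_ge0 (u j)) (y1 j); lra.
  + rewrite det2_shear cmodM; apply: ler_pM; rewrite ?(ltW t0) ?(ltW delta0) //.
    have := cmod_lowerD 1 (- (x j * y j)); rewrite cmod1 cmodN cmodM.
    have : cmod (x j) * cmod (y j) <= (1 - t) * 1.
      by apply: ler_pM; rewrite ?cmod_ge0 //; case: (hx j).
    lra.
- move=> j; have [Bu Bs [h1 h2] h3 [h4 h5]] := hc j.
  have dx := moebius_den_gt0 t1 (a0 j) h1 h5 (x1 j).
  have dy : 0 < cmod (al j + - r j * y (j + 1)).
    by apply: (moebius_den_gt0 t1 (a0 j) h1); rewrite ?cmodN.
  move: dx dy; rewrite !cmod_gt0 => dx dy; split.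
  + rewrite mulmxDr -scalemxAr Bu Bs (hx j).2.
    by apply/colP => i; rewrite !mxE; field.
  + rewrite mulmxDr -scalemxAr Bu Bs (hy j).2.
    by apply/colP => i; rewrite !mxE; field.
- move=> j; have [_ _ [h1 h2] h3 [h4 h5]] := hc j; split.
  + apply: le_trans (moebius_den_ge h1 h5 (x1 j)); have := (ad j).1.
    by apply: ler_wpM2l; lra.
  + have hd : cmod (be j + r j * y j) <= (1 - 8 * t) * cmod (a j).
      apply: le_trans (cmodD _ _) _; rewrite cmodM.
      by have := ler_piMr (cmod_ge0 (r j)) (y1 j); rewrite -/(r j) in h4 *; lra.
    apply: le_trans hd _.
    (* Here [1 - 8 * t] is at most [(1 - t) * (1 - 2 * t)]. *)
    apply: (@le_trans _ _ ((1 - t) * ((1 - 2 * t) * cmod (a j)))).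
      rewrite mulrA ler_wpM2r ?cmod_ge0 //.
      by have := mulr_gt0 t0 t0; lra.
    apply: ler_wpM2l; first exact: r0.
    exact: le_trans (moebius_den_ge h1 h5 (x1 j)).
Qed.

End DominatedFrame.

(** * From a dominated frame to a dominated splitting *)

Section FrameSplitting.
Variable R : realType.
Implicit Types B : int -> 'M[R[i]]_2.

(** The cocycle multiplies frame vectors by products of the [a] or of the [d], whose ratio decays
    like [rho ^+ n]. Enough steps outweigh the distortion caused by frame lengths between
    [delta / K] and [K]. *)
Lemma dominated_frame_splitting B :
  bounded_seq B -> dominated_frame B -> dominated_splitting B.
Proof.
move=> bB [u [s [a [d [K [delta [m [rho [[K0 delta0 m0 rho0 rho1] us Bus ad]]]]]]]]].
have lowK j : delta / K <= vnorm (u j) /\ delta / K <= vnorm (s j).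
  have [uK sK dj] := us j; have := le_trans dj (det2_le _ _).
  rewrite !ler_pdivrMr // => h; split; apply: le_trans h _.
    by rewrite ler_wpM2l ?vnorm_ge0.
  by rewrite mulrC ler_wpM2l ?vnorm_ge0.
have dK0 : 0 < delta / K by rewrite divr_gt0.
have u0 j : u j != 0.
  by rewrite -vnorm_gt0; case: (lowK j) => h _; exact: lt_le_trans h.
have s0 j : s j != 0.
  by rewrite -vnorm_gt0; case: (lowK j) => _ h; exact: lt_le_trans h.
have growth n j : m ^+ n <= \prod_(k < n) cmod (a (j + k%:Z)).
  elim: n => [|n ih]; first by rewrite expr0 big_ord0.
  rewrite exprSr big_ord_recr /=; apply: ler_pM; rewrite ?exprn_ge0 ?(ltW m0) //.
  by case: (ad (j + n%:Z)).
have decay n j : \prod_(k < n) cmod (d (j + k%:Z)) <=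
    rho ^+ n * \prod_(k < n) cmod (a (j + k%:Z)).
  elim: n => [|n ih]; first by rewrite expr0 !big_ord0 mulr1.
  rewrite exprSr !big_ord_recr /= mulrACA; apply: ler_pM; rewrite ?cmod_ge0 //.
    by apply: prodr_ge0 => k _; exact: cmod_ge0.
  by case: (ad (j + n%:Z)).
(* The threshold gives domination with [lambda = 2]: each of the two normalisations and each of the
   two final frame lengths contributes to the square. The exponent is then raised by one to be
   positive. *)
have [N hN] : exists N, rho ^+ N < (delta / K / K) ^+ 2 / 2.
  by apply: expr_small => //; rewrite divr_gt0 // exprn_gt0 // divr_gt0.
have {}hN : rho ^+ N.+1 < (delta / K / K) ^+ 2 / 2.
  by apply: le_lt_trans hN; rewrite exprS ler_piMl ?exprn_ge0 // ltW.
have u_grows n j : delta / K * \prod_(k < n) cmod (a (j + k%:Z)) <=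
    vnorm (cocycle B n j *m u j).
  rewrite (cocycle_eigen _ _ (fun j => (Bus j).1)) vnormZ.
  rewrite (cmod_prod _ (fun k => a (j + k%:Z))) mulrC.
  apply: ler_wpM2l; last by case: (lowK (j + n%:Z)).
  by apply: prodr_ge0 => k _; exact: cmod_ge0.
have s_decays n j : vnorm (cocycle B n j *m s j) <=
    K * (rho ^+ n * \prod_(k < n) cmod (a (j + k%:Z))).
  rewrite (cocycle_eigen _ _ (fun j => (Bus j).2)) vnormZ mulrC.
  rewrite (cmod_prod _ (fun k => d (j + k%:Z))).
  apply: ler_pM; rewrite ?vnorm_ge0 //; last by case: (us (j + n%:Z)).
  by apply: prodr_ge0 => k _; exact: cmod_ge0.
split=> //; exists (fun j => <[u j]>%VS), (fun j => <[s j]>%VS).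
split; first by move=> j; rewrite !dim_vline u0 s0.
split.
  move=> j; split=> _ /vlineP[c ->].
    by rewrite -scalemxAr (Bus j).1 !memvZ ?memv_line.
  by rewrite -scalemxAr (Bus j).2 !memvZ ?memv_line.
split; last first.
  (* The factor 2 in [vdist] makes the bound strict. *)
  exists (delta / (K * K)); split; first by rewrite divr_gt0 ?mulr_gt0.
  move=> j; rewrite (@line_distE _ _ _ (u j) (s j)) ?dim_vline ?u0 ?s0 ?memv_line //.
  have [uK sK dj] := us j.
  rewrite /vdist det_row_mx ltr_pdivlMr ?mulr_gt0 ?vnorm_gt0 //.
  apply: (@le_lt_trans _ _ delta); last by lra.
  rewrite -mulrA ler_piMr ?(ltW delta0) // mulrC ler_pdivrMr ?mulr_gt0 // mul1r.
  by apply: ler_pM; rewrite ?vnorm_ge0.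
exists N.+1, 2; split=> //; split; first by lra.
split.
  move=> j _ _ /vlineP[x ->] /vlineP[y ->]; rewrite !vnormZ => x1 y1.
  rewrite -!scalemxAr !vnormZ.
  set P := \prod_(k < N.+1) cmod (a (j + k%:Z)).
  have P0 : 0 < P by apply: lt_le_trans (growth N.+1 j); rewrite exprn_gt0.
  have xlow : K^-1 <= cmod x.
    have : 0 < vnorm (u j) by rewrite vnorm_gt0.
    move=> h; rewrite -[cmod x](mulfK (lt0r_neq0 h)) x1 mul1r lef_pV2 ?posrE //.
    by case: (us j).
  have yup : cmod y <= (delta / K)^-1.
    have h : 0 < vnorm (s j) by rewrite vnorm_gt0.
    rewrite -[cmod y](mulfK (lt0r_neq0 h)) y1 mul1r lef_pV2 ?posrE //.
    by case: (lowK j).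
  apply: (@lt_le_trans _ _ (K^-1 * (delta / K * P))); last first.
    apply: ler_pM; rewrite ?mulr_ge0 ?invr_ge0 ?(ltW K0) ?(ltW delta0) ?(ltW P0) //.
    exact: u_grows.
  apply: (@le_lt_trans _ _ (2 * ((delta / K)^-1 * (K * (rho ^+ N.+1 * P))))).
    rewrite ler_pM2l ?ltr0n //; apply: ler_pM; rewrite ?cmod_ge0 ?vnorm_ge0 //.
  have -> : 2 * ((delta / K)^-1 * (K * (rho ^+ N.+1 * P))) =
    rho ^+ N.+1 * (2 * (K * K) / delta * P) by field; rewrite !gt_eqF.
  have -> : K^-1 * (delta / K * P) =
    ((delta / K / K) ^+ 2 / 2) * (2 * (K * K) / delta * P).
    by field; rewrite !gt_eqF.
  by rewrite ltr_pM2r // !mulr_gt0 ?invr_gt0.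
apply: (@lt_le_trans _ _ (delta / K / K * m ^+ N.+1)).
  by rewrite mulr_gt0 ?exprn_gt0 // divr_gt0.
apply: lb_le_inf; first by exists (opnorm (cocycle B N.+1 0)), 0.
(* The operator norm is bounded below by testing on [u j], whose growth is at least that of
   [m ^+ N.+1]. *)
move=> _ [j _ <-]; apply: (opnorm_ge (u0 j)).
apply: le_trans (u_grows N.+1 j).
have -> : delta / K / K * m ^+ N.+1 * vnorm (u j) =
    delta / K * (m ^+ N.+1 * (vnorm (u j) / K)) by ring.
rewrite ler_pM2l //; apply: le_trans (growth N.+1 j).
rewrite ler_piMr ?exprn_ge0 ?(ltW m0) // ler_pdivrMr // mul1r.
by case: (us j).
Qed.

End FrameSplitting.

(** * From a dominated splitting to a dominated frame *)

Section SplittingFrame.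
Variable R : realType.
Implicit Types B : int -> 'M[R[i]]_2.

Lemma line_unit (V : {vspace 'cV[R[i]]_2}) : \dim V = 1%N ->
  exists u, [/\ u \in V, vnorm u = 1 & forall v, v \in V -> exists c, v = c *: u].
Proof.
move=> dV; have v0 : vpick V != 0 by rewrite vpick0 -dimv_eq0 dV.
set u := (vnorm (vpick V))^-1%:C *: vpick V.
have u1 : vnorm u = 1 by exact: vnorm_normalize.
have uV : u \in V by rewrite memvZ ?memv_pick.
exists u; split=> // v vV; apply/vlineP.
have /eqP -> // : (<[u]> == V)%VS.
by rewrite eqEdim -memvE uV dV dim_vline -vnorm_gt0 u1 ltr01.
Qed.

(* The standard adapted-metric trick: averaging over a window of length N turns
   contraction in N steps into contraction in one step. *)
Lemma adapted_weights (r : int -> R) (Q : R) N :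
  (forall j, 0 <= r j <= Q) -> (forall j, \prod_(k < N.+1) r (j + k%:Z) <= 1) ->
  exists (tau : int -> R) (C : R), forall j,
    [/\ 1 <= tau j, tau j <= C & r j * tau (j + 1) <= tau j].
Proof.
move=> rQ rN; pose q k j := \prod_(i < k) r (j + i%:Z).
have q0 k j : 0 <= q k j by apply: prodr_ge0 => i _; case/andP: (rQ (j + i%:Z)).
have qS k j : r j * q k (j + 1) = q k.+1 j.
  rewrite /q big_ord_recl addr0; congr (_ * _); apply: eq_bigr => i _.
  by rewrite -addrA -PoszD.
exists (fun j => \sum_(k < N.+1) q k j), (\sum_(k < N.+1) Q ^+ k) => j; split.
- rewrite big_ord_recl {1}/q big_ord0 lerDl.
  by apply: sumr_ge0.
- apply: ler_sum => k _; rewrite -[X in _ <= _ ^+ X]card_ord -prodr_const.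
  by apply: ler_prod => i _; exact: rQ.
(* The shifted sum trades the empty product 1 for the product over the full window, which is at most
   1. *)
- rewrite mulr_sumr (eq_bigr (fun k : 'I_N.+1 => q k.+1 j)) => [|k _]; last exact: qS.
  rewrite big_ord_recr [leRHS]big_ord_recl /= addrC lerD //.
  by rewrite [leRHS]big_ord0; exact: rN.
Qed.

(** Unit vectors spanning the two lines form a transversal frame. The lower bound on [a] comes from
    that on the norms of the cocycle, and domination in one step from dividing [s j] by adapted
    weights. *)
Lemma dominated_splitting_frame B : dominated_splitting B -> dominated_frame B.
Proof.
move=> [/bounded_seqP[M M1 BM] [Eu [Es [dimE [invE [[N [lam dom]] [delta [delta0 dist]]]]]]]].
move: dom; case: N => [[]//|N] [_ [lam1 [dom inf0]]].
have [u hu] := choice (fun j => line_unit (dimE j).1).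
have [s hs] := choice (fun j => line_unit (dimE j).2).
have [a Bu] : exists a : int -> R[i], forall j, B j *m u j = a j *: u (j + 1).
  have h j : exists c, B j *m u j = c *: u (j + 1).
    have [uE _ _] := hu j; have [_ _] := hu (j + 1).
    by apply; exact: (invE j).1.
  by have [a] := choice h; exists a.
have [d Bs] : exists d : int -> R[i], forall j, B j *m s j = d j *: s (j + 1).
  have h j : exists c, B j *m s j = c *: s (j + 1).
    have [sE _ _] := hs j; have [_ _] := hs (j + 1).
    by apply; exact: (invE j).2.
  by have [d] := choice h; exists d.
have u1 j : vnorm (u j) = 1 by case: (hu j).
have s1 j : vnorm (s j) = 1 by case: (hs j).
have det_ge j : delta / 2 <= cmod (det2 (u j) (s j)).
  have [uE _ _] := hu j; have [sE _ _] := hs j.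
  have := dist j; rewrite (@line_distE _ _ _ (u j) (s j)) //; last first.
  - by rewrite -vnorm_gt0 s1.
  - by rewrite -vnorm_gt0 u1.
  - by case: (dimE j).
  - by case: (dimE j).
  by rewrite /vdist det_row_mx u1 s1 mul1r divr1; lra.
have aM j : cmod (a j) <= M.
  by have := BM j (u j); rewrite Bu vnormZ !u1 !mulr1.
have dM j : cmod (d j) <= M.
  by have := BM j (s j); rewrite Bs vnormZ !s1 !mulr1.
pose Pa n j := \prod_(k < n) cmod (a (j + k%:Z)).
pose Pd n j := \prod_(k < n) cmod (d (j + k%:Z)).
have PaE n j : vnorm (cocycle B n j *m u j) = Pa n j.
  by rewrite (cocycle_eigen _ _ Bu) vnormZ u1 mulr1 (cmod_prod _ (fun k => a (j + k%:Z))).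
have PdE n j : vnorm (cocycle B n j *m s j) = Pd n j.
  by rewrite (cocycle_eigen _ _ Bs) vnormZ s1 mulr1 (cmod_prod _ (fun k => d (j + k%:Z))).
have Pd_lt j : lam * Pd N.+1 j < Pa N.+1 j.
  by rewrite -PaE -PdE; apply: dom => //; [case: (hu j)|case: (hs j)].
have Pd0 n j : 0 <= Pd n j by apply: prodr_ge0 => k _; exact: cmod_ge0.
(* A unit vector has coordinates at most [2 / delta] in the frame, and [Pd] is below [Pa], so the
   operator norm of the cocycle is at most [4 / delta * Pa N.+1 j]. *)
have [c c0 Pa_ge] : exists2 c, 0 < c & forall j, c <= Pa N.+1 j.
  set c := inf _ in inf0; exists (c * delta / 4) => [|j].
    by rewrite divr_gt0 ?mulr_gt0.
  have cB : c <= opnorm (cocycle B N.+1 j).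
    apply: ge_inf; last by exists j.
    exists 0 => _ [k _ <-]; apply: le_trans (vnorm_ge0 (cocycle B N.+1 k *m u k)) _.
    by have := vnorm_mulmx_le (cocycle B N.+1 k) (u k); rewrite u1 mulr1.
  suff : opnorm (cocycle B N.+1 j) <= 4 / delta * Pa N.+1 j.
    move=> h; have := le_trans cB h.
    by rewrite [4 / _ * _]mulrAC ler_pdivlMr // ler_pdivrMr // (mulrC 4).
  apply: opnorm_le => v v1.
  have det0 : 0 < cmod (det2 (u j) (s j)).
    by apply: lt_le_trans (det_ge j); rewrite divr_gt0.
  have [x [y [vE hx hy]]] := @det2_decomp _ (u j) (s j) v (etrans (esym (cmod_gt0 _)) det0).
  rewrite v1 s1 u1 mul1r in hx hy.
  have dinv : 1 / cmod (det2 (u j) (s j)) <= 2 / delta.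
    by rewrite ler_pdivrMr // mulrAC ler_pdivlMr // mul1r; have := det_ge j; lra.
  rewrite vE mulmxDr -!scalemxAr; apply: le_trans (vnormD _ _) _.
  rewrite !vnormZ PaE PdE.
  have -> : 4 / delta * Pa N.+1 j = 2 / delta * Pa N.+1 j + 2 / delta * Pa N.+1 j.
    by ring.
  apply: lerD; apply: ler_pM; rewrite ?cmod_ge0 //.
  - by apply: prodr_ge0 => k _; exact: cmod_ge0.
  - exact: le_trans hx dinv.
  - exact: le_trans hy dinv.
  - by apply: ltW; apply: le_lt_trans (Pd_lt j); rewrite ler_peMl // ltW.
have M0 : 0 < M by lra.
(* One factor of [Pa N.+1 j] is [cmod (a j)]; each of the other [N] is at most [M]. *)
pose m := c / M ^+ N.
have m0 : 0 < m by rewrite divr_gt0 ?exprn_gt0.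
have am j : m <= cmod (a j).
  rewrite ler_pdivrMr ?exprn_gt0 //; apply: le_trans (Pa_ge j) _.
  rewrite /Pa big_ord_recl addr0; apply: ler_wpM2l; first exact: cmod_ge0.
  rewrite -[X in _ <= _ ^+ X]card_ord -prodr_const; apply: ler_prod => k _.
  by rewrite cmod_ge0 aM.
have a0 j : 0 < cmod (a j) by exact: lt_le_trans (am j).
(* By Bernoulli's inequality the rate [1 - h], applied [N.+1] times, is still at least [lam^-1]. *)
pose h := (1 - lam^-1) / N.+1%:R.
have lam0 : 0 < lam by lra.
have h0 : 0 < h by rewrite divr_gt0 // subr_gt0 invf_lt1.
have h1 : h < 1.
  rewrite ltr_pdivrMr // mul1r; apply: (@lt_le_trans _ _ 1); last by rewrite ler1n.
  by have : 0 < lam^-1 by [rewrite invr_gt0]; lra.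
have hlam : lam^-1 <= (1 - h) ^+ N.+1.
  have hN : N.+1%:R * h = 1 - lam^-1 by rewrite mulrC divfK ?pnatr_eq0.
  apply: le_trans (bernoulli_ineq N.+1 _); last by rewrite lerN2 ltW.
  by rewrite mulrN hN; lra.
have r0 : 0 < 1 - h by lra.
(* After division by [1 - h] the ratios of [d] to [a] still have product at most 1 over each window;
   the weights then give the one-step rate [1 - h]. *)
have [|j|tau [C htau]] :=
    @adapted_weights (fun j => cmod (d j) / cmod (a j) / (1 - h)) (M / m / (1 - h)) N.
- move=> j; rewrite !divr_ge0 ?cmod_ge0 ?(ltW r0) //=.
  rewrite ler_pM2r ?invr_gt0 //; apply: ler_pM; rewrite ?invr_ge0 ?cmod_ge0 //.
  by rewrite lef_pV2 ?posrE.
- rewrite 2!big_split /= !prodfV prodr_const card_ord.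
  rewrite -/(Pd N.+1 j) -/(Pa N.+1 j) ler_pdivrMr ?exprn_gt0 // mul1r.
  apply: le_trans hlam; rewrite ler_pdivrMr; last exact: lt_le_trans (Pa_ge j).
  by rewrite mulrC ler_pdivlMr // mulrC ltW.
have tau0 j : 0 < tau j by case: (htau j); lra.
exists u, (fun j => (tau j)^-1%:C *: s j), a.
exists (fun j => (tau (j + 1) / tau j)%:C * d j), 1, (delta / 2 / C), m, (1 - h).
have C0 : 0 < C by case: (htau 0); lra.
split.
- by split=> //; rewrite ?divr_gt0 ?ltW //; lra.
- move=> j; have [t1 tC _] := htau j; split; first by rewrite u1.
    by rewrite vnormZ s1 mulr1 cmod_real ger0_norm ?invf_le1 // invr_ge0 ltW.
  rewrite -[u j]scale1r det2Z mul1r cmodM cmod_real ger0_norm ?invr_ge0 ?(ltW (tau0 j)) // mulrC.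
  apply: ler_pM; rewrite ?divr_ge0 ?invr_ge0 ?(ltW C0) ?(ltW delta0) //.
  by rewrite lef_pV2 ?posrE.
- move=> j; split=> //; rewrite -scalemxAr Bs !scalerA; congr (_ *: _).
  rewrite [RHS]mulrAC -rmorphM; congr (_%:C * _).
  by field; rewrite !gt_eqF.
move=> j; split=> //; have [_ _] := htau j.
have tt0 : 0 <= tau (j + 1) / tau j by rewrite divr_ge0 ?(ltW (tau0 _)).
rewrite mulrAC ler_pdivrMr // mulrAC ler_pdivrMr // => h2.
rewrite cmodM cmod_real ger0_norm // mulrAC ler_pdivrMr // mulrC; lra.
Qed.

End SplittingFrame.

(** * Openness of dominated splitting in the sup norm *)

Theorem theorem5 (R : realType) (B : int -> 'M[R[i]]_2) :
  bounded_seq B -> dominated_splitting B ->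
  exists eps : R, 0 < eps /\
    forall B' : int -> 'M[R[i]]_2,
      (seqnorm (fun j => (B' j - B j)%R) < eps%:E)%E ->
      dominated_splitting B'.
Proof.
move=> bB /dominated_splitting_frame/dominated_frame_open[eps eps0 stable].
exists eps; split; first exact: eps0.
move=> B' /ltW small; have {small}near := (seqnorm_leP _ _).1 small.
have [M M1 BM] := (bounded_seqP B).1 bB.
apply: dominated_frame_splitting; last exact: (stable B' near).
(* Boundedness of [B'] is part of its splitting and follows by the triangle inequality. *)
apply/bounded_seqP; exists (M + eps) => [|j v]; first by rewrite ler_wpDr ?(ltW eps0).
have -> : B' j *m v = B j *m v + (B' j - B j) *m v by rewrite mulmxBl addrC subrK.
rewrite mulrDl; apply: le_trans (vnormD _ _) _.
exact: lerD (BM j v) (near j v).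
Qed.
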